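(* Let $b\in\mathbb{C}$ and let $p_2(T)=p_2(T;b)=(T+b^2)(T+b^2-2)$. Then, as differential operators, $$\hat A^\dagger\hat A=p_2(T_2).$$
   Context: The differential operators in $x$ are $T_2=\partial_x^2-2x\partial_x$, $U=\partial_x+b$, $V=-\partial_x+2x+b$, $$\hat A=T_2+b^2-(x+b)^{-1}U,\qquad \hat A^\dagger=T_2+b^2-V\circ(x+b)^{-1},$$ with products of operators denoting composition. *)

(* Defs.v *)
From HB Require Import structures.
From mathcomp Require Import all_boot all_order all_algebra.
From mathcomp Require Import fraction ring.
From mathcomp Require Export reals complex.

Set Implicit Arguments.
Unset Strict Implicit.
Unset Printing Implicit Defensive.

Import GRing.Theory.
Local Open Scope ring_scope.
Local Open Scope quotient_scope.

Notation ratfun F := {fraction {poly F}}.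
Notation "p %:F" := (@FracField.tofrac _ p) : ring_scope.

(* Quotient rule on the canonical representative; [rdiffE] shows that any
   representative gives the same result. *)
Definition rdiff (F : fieldType) (f : ratfun F) : ratfun F :=
  let n := \n_(repr f) in let d := \d_(repr f) in
  (n^`() * d - n * d^`())%:F / d%:F ^+ 2.

Lemma ratfunE (F : fieldType) (f : ratfun F) :
  f = (\n_(repr f))%:F / (\d_(repr f))%:F.
Proof.
have nz : (\d_(repr f))%:F != 0 :> ratfun F by rewrite tofrac_eq0 denom_ratioP.
apply: (mulIf nz); rewrite divfK // -{1}[f]reprK.
move: (repr f) => r; unlock FracField.tofrac.
rewrite -[LHS]FracField.pi_mul; apply/eqmodP.
by rewrite /= FracField.equivfE /FracField.mulf !numden_Ratio
   ?mulf_neq0 ?denom_ratioP ?oner_eq0 // !mulr1 mulrC.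
Qed.

Lemma ratfun_eq (F : fieldType) (n d N D : {poly F}) : d != 0 -> D != 0 ->
  (n%:F / d%:F == N%:F / D%:F :> ratfun F) = (n * D == N * d).
Proof.
move=> nzd nzD.
have dF : d%:F != 0 :> ratfun F by rewrite tofrac_eq0.
have DF : D%:F != 0 :> ratfun F by rewrite tofrac_eq0.
by rewrite (eqr_div _ _ dF DF) -(tofracM n D) -(tofracM N d) tofrac_eq.
Qed.

Lemma rdiffE (F : fieldType) (n d : {poly F}) :
  d != 0 -> rdiff (n%:F / d%:F) = (n^`() * d - n * d^`())%:F / d%:F ^+ 2.
Proof.
move=> nzd; rewrite /rdiff.
set f := n%:F / d%:F; have := ratfunE f.
have := denom_ratioP (repr f).
move: (\n_(repr f)) (\d_(repr f)) => N D nzD; rewrite {}/f => /eqP.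
rewrite ratfun_eq // => /eqP E.
have /= E' := congr1 (@deriv F) E; rewrite !derivM in E'.
apply/eqP; rewrite -(tofracXn 2 D) -(tofracXn 2 d) ratfun_eq ?expf_neq0 //.
apply/eqP.
transitivity (D * d * (N^`() * d + N * d^`()) - D * d^`() * (N * d)
              - d * D^`() * (N * d)); first by ring.
by rewrite -E' -E; ring.
Qed.

Lemma rdiff_poly (F : fieldType) (p : {poly F}) : rdiff p%:F = p^`()%:F.
Proof.
rewrite -[p%:F]divr1 -tofrac1 rdiffE ?oner_eq0 //.
by rewrite -polyC1 derivC polyC1 mulr0 mulr1 subr0 tofrac1 expr1n divr1.
Qed.

(* Stated over an abstract field: [field] unfolds {fraction _} otherwise. *)
Lemma quotient_ruleD (K : fieldType) (m c n d m1 c1 n1 d1 : K) :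
  c != 0 -> d != 0 ->
  ((m1 * d + m * d1 + (n1 * c + n * c1)) * (c * d)
     - (m * d + n * c) * (c1 * d + c * d1)) / (c * d) ^+ 2
  = (m1 * c - m * c1) / c ^+ 2 + (n1 * d - n * d1) / d ^+ 2.
Proof. by move=> nzc nzd; field; apply/andP. Qed.

Lemma quotient_ruleM (K : fieldType) (m c n d m1 c1 n1 d1 : K) :
  c != 0 -> d != 0 ->
  ((m1 * n + m * n1) * (c * d) - (m * n) * (c1 * d + c * d1)) / (c * d) ^+ 2
  = (m1 * c - m * c1) / c ^+ 2 * (n / d) + m / c * ((n1 * d - n * d1) / d ^+ 2).
Proof. by move=> nzc nzd; field; apply/andP. Qed.

Lemma rdiffD (F : fieldType) : {morph @rdiff F : f g / f + g}.
Proof.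
move=> f g; rewrite [f]ratfunE [g]ratfunE.
have := denom_ratioP (repr f); have := denom_ratioP (repr g).
move: (\n_(repr f)) (\d_(repr f)) (\n_(repr g)) (\d_(repr g)).
move=> m c n d nzd nzc.
have dF : d%:F != 0 :> ratfun F by rewrite tofrac_eq0.
have cF : c%:F != 0 :> ratfun F by rewrite tofrac_eq0.
rewrite (addf_div _ _ cF dF) -(tofracM m d) -(tofracM n c) -(tofracM c d).
rewrite -(tofracD (m * d)) (rdiffE _ (mulf_neq0 nzc nzd)) (rdiffE m nzc).
rewrite (rdiffE n nzd) derivD !derivM.
rewrite !(tofracB, tofracD) !tofracM !tofracD !tofracM.
exact: quotient_ruleD cF dF.
Qed.

Lemma rdiffM (F : fieldType) (f g : ratfun F) :
  rdiff (f * g) = rdiff f * g + f * rdiff g.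
Proof.
rewrite [f]ratfunE [g]ratfunE.
have := denom_ratioP (repr f); have := denom_ratioP (repr g).
move: (\n_(repr f)) (\d_(repr f)) (\n_(repr g)) (\d_(repr g)).
move=> m c n d nzd nzc.
have dF : d%:F != 0 :> ratfun F by rewrite tofrac_eq0.
have cF : c%:F != 0 :> ratfun F by rewrite tofrac_eq0.
rewrite mulf_div -(tofracM m n) -(tofracM c d).
rewrite (rdiffE _ (mulf_neq0 nzc nzd)) (rdiffE m nzc) (rdiffE n nzd) !derivM.
rewrite !tofracB !tofracM !tofracD !tofracM.
exact: quotient_ruleM cF dF.
Qed.

Lemma rdiffB (F : fieldType) : zmod_morphism (@rdiff F).
Proof.
move=> f g; have d0 : rdiff 0 = 0 :> ratfun F.
  by apply: (addIr (rdiff 0)); rewrite -rdiffD !add0r.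
rewrite rdiffD; congr (_ + _); apply: (addIr (rdiff g)).
by rewrite -rdiffD !addNr.
Qed.

HB.instance Definition _ (F : fieldType) :=
  GRing.isZmodMorphism.Build (ratfun F) (ratfun F) (@rdiff F) (@rdiffB F).

(* Differential operators \sum_i f_i \partial^i with rational-function
   coefficients f_i written on the left; f_i is the i-th coefficient of
   [symb P].  The record keeps the composition product below apart from the
   commutative product of {poly _}. *)
Record diffop (F : fieldType) := DiffOp { symb : {poly ratfun F} }.

HB.instance Definition _ (F : fieldType) := [isNew for @symb F].
HB.instance Definition _ (F : fieldType) := [Choice of diffop F by <:].

Definition dop_add (F : fieldType) (P Q : diffop F) := DiffOp (symb P + symb Q).
Definition dop_opp (F : fieldType) (P : diffop F) := DiffOp (- symb P).

Lemma dop_addA (F : fieldType) : associative (@dop_add F).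
Proof. by move=> P Q S; apply: val_inj; rewrite /= addrA. Qed.
Lemma dop_addC (F : fieldType) : commutative (@dop_add F).
Proof. by move=> P Q; apply: val_inj; rewrite /= addrC. Qed.
Lemma dop_add0 (F : fieldType) : left_id (DiffOp 0) (@dop_add F).
Proof. by move=> P; apply: val_inj; rewrite /= add0r. Qed.
Lemma dop_addN (F : fieldType) : left_inverse (DiffOp 0) (@dop_opp F) (@dop_add F).
Proof. by move=> P; apply: val_inj; rewrite /= addNr. Qed.

HB.instance Definition _ (F : fieldType) :=
  GRing.isZmodule.Build (diffop F)
    (@dop_addA F) (@dop_addC F) (@dop_add0 F) (@dop_addN F).

(* \partial \circ Q, from the Leibniz rule
   \partial \circ (f \partial^i) = f' \partial^i + f \partial^(i+1). *)
Definition dcomp1 (F : fieldType) (q : {poly ratfun F}) : {poly ratfun F} :=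
  map_poly (@rdiff F) q + q * 'X.

Definition dcomp (F : fieldType) (p q : {poly ratfun F}) : {poly ratfun F} :=
  \sum_(i < size p) p`_i *: iter i (@dcomp1 F) q.

Lemma dcomp_widen (F : fieldType) n (p q : {poly ratfun F}) : (size p <= n)%N ->
  dcomp p q = \sum_(i < n) p`_i *: iter i (@dcomp1 F) q.
Proof.
move=> le_pn; rewrite /dcomp (big_ord_widen _ (fun i => p`_i *: iter i _ q) le_pn).
rewrite big_mkcond; apply: eq_bigr => i _; case: ltnP => // le_pi.
by rewrite nth_default // scale0r.
Qed.

Lemma dcomp1D (F : fieldType) : {morph @dcomp1 F : p q / p + q}.
Proof. by move=> p q; rewrite /dcomp1 raddfD mulrDl addrACA. Qed.

Lemma dcomp1_0 (F : fieldType) : @dcomp1 F 0 = 0.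
Proof. by rewrite /dcomp1 raddf0 mul0r addr0. Qed.

Lemma dcomp1_sum (F : fieldType) n (G : 'I_n -> {poly ratfun F}) :
  dcomp1 (\sum_i G i) = \sum_i dcomp1 (G i).
Proof. exact: (big_morph _ (@dcomp1D F) (dcomp1_0 F)). Qed.

Lemma dcomp1Z (F : fieldType) (f : ratfun F) q :
  dcomp1 (f *: q) = rdiff f *: q + f *: dcomp1 q.
Proof.
rewrite /dcomp1 scalerDr scalerAl addrA; congr (_ + _); apply/polyP => i.
by rewrite !(coef_map, coefD, coefZ) /= rdiffM.
Qed.

Lemma iter_dcomp1D (F : fieldType) i : {morph iter i (@dcomp1 F) : p q / p + q}.
Proof. by move=> p q; elim: i => //= i ->; rewrite dcomp1D. Qed.

Lemma dcompDl (F : fieldType) (p q s : {poly ratfun F}) :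
  dcomp (p + q) s = dcomp p s + dcomp q s.
Proof.
set n := maxn (size p) (size q).
rewrite !(@dcomp_widen _ n) ?leq_maxl ?leq_maxr ?size_polyD // -big_split /=.
by apply: eq_bigr => i _; rewrite coefD scalerDl.
Qed.

Lemma dcompDr (F : fieldType) (p q s : {poly ratfun F}) :
  dcomp p (q + s) = dcomp p q + dcomp p s.
Proof.
by rewrite -big_split; apply: eq_bigr => i _; rewrite iter_dcomp1D scalerDr.
Qed.

Lemma dcompZl (F : fieldType) (f : ratfun F) p q :
  dcomp (f *: p) q = f *: dcomp p q.
Proof.
rewrite (@dcomp_widen _ (size p)) ?size_scale_leq // scaler_sumr.
by apply: eq_bigr => i _; rewrite coefZ scalerA.
Qed.

Lemma dcomp0l (F : fieldType) (q : {poly ratfun F}) : dcomp 0 q = 0.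
Proof. by rewrite /dcomp size_poly0 big_ord0. Qed.

Lemma dcomp_suml (F : fieldType) n (G : 'I_n -> {poly ratfun F}) q :
  dcomp (\sum_i G i) q = \sum_i dcomp (G i) q.
Proof.
exact: (big_morph (fun p => dcomp p q) (fun _ _ => dcompDl _ _ _) (dcomp0l q)).
Qed.

Lemma dcompXl (F : fieldType) (p q : {poly ratfun F}) :
  dcomp (p * 'X) q = \sum_(i < size p) p`_i *: iter i.+1 (@dcomp1 F) q.
Proof.
have le : (size (p * 'X)%R <= (size p).+1)%N.
  by apply: leq_trans (size_polyMleq _ _) _; rewrite size_polyX addn2.
rewrite (dcomp_widen _ le) big_ord_recl coefMX scale0r add0r.
by apply: eq_bigr => i _; rewrite coefMX.
Qed.

Lemma dcomp1_comp (F : fieldType) (p q : {poly ratfun F}) :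
  dcomp1 (dcomp p q) = dcomp (dcomp1 p) q.
Proof.
rewrite dcompDl dcompXl dcomp1_sum (@dcomp_widen _ (size p)) ?size_poly //.
rewrite -big_split; apply: eq_bigr => i _.
by rewrite dcomp1Z coef_map.
Qed.

Lemma dcompA (F : fieldType) : associative (@dcomp F).
Proof.
move=> p q s; rewrite [dcomp p q]/dcomp dcomp_suml; apply: eq_bigr => i _.
rewrite dcompZl; congr (_ *: _).
by elim: (i : nat) => //= j ->; rewrite dcomp1_comp.
Qed.

Lemma dcompCl (F : fieldType) (f : ratfun F) q : dcomp f%:P q = f *: q.
Proof.
rewrite (@dcomp_widen _ 1) ?size_polyC_leq1 // big_ord_recl big_ord0 addr0.
by rewrite coefC.
Qed.

Lemma rdiff_const (F : fieldType) (c : F) : rdiff (c%:P%:F) = 0.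
Proof. by rewrite rdiff_poly derivC tofrac0. Qed.

Lemma dcomp1r (F : fieldType) (p : {poly ratfun F}) : dcomp p 1 = p.
Proof.
have it i : iter i (@dcomp1 F) 1 = 'X^i.
  elim: i => //= i ->; rewrite /dcomp1 -exprSr [map_poly _ _](_ : _ = 0) ?add0r //.
  apply/polyP => j; rewrite coef_map coefXn coef0 /=.
  case: (_ == _); last by rewrite raddf0.
  by rewrite -tofrac1 -polyC1 rdiff_const.
rewrite -[RHS]coefK poly_def.
by apply: eq_bigr => i _; rewrite it.
Qed.

Definition dop_mul (F : fieldType) (P Q : diffop F) : diffop F :=
  DiffOp (dcomp (symb P) (symb Q)).

Lemma dop_mulA (F : fieldType) : associative (@dop_mul F).
Proof. by move=> P Q S; apply: val_inj; rewrite /= dcompA. Qed.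
Lemma dop_mul1 (F : fieldType) : left_id (DiffOp 1) (@dop_mul F).
Proof. by move=> P; apply: val_inj; rewrite /= -polyC1 dcompCl scale1r. Qed.
Lemma dop_mulr1 (F : fieldType) : right_id (DiffOp 1) (@dop_mul F).
Proof. by move=> P; apply: val_inj; rewrite /= dcomp1r. Qed.
Lemma dop_mulDl (F : fieldType) : left_distributive (@dop_mul F) +%R.
Proof. by move=> P Q S; apply: val_inj; rewrite /= dcompDl. Qed.
Lemma dop_mulDr (F : fieldType) : right_distributive (@dop_mul F) +%R.
Proof. by move=> P Q S; apply: val_inj; rewrite /= dcompDr. Qed.
Lemma dop_1neq0 (F : fieldType) : DiffOp 1 != 0 :> diffop F.
Proof. by rewrite -(inj_eq val_inj) /= oner_neq0. Qed.

(* The product of operators is their composition; see [dapplyM]. *)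
HB.instance Definition _ (F : fieldType) :=
  GRing.Zmodule_isNzRing.Build (diffop F) (@dop_mulA F) (@dop_mul1 F)
    (@dop_mulr1 F) (@dop_mulDl F) (@dop_mulDr F) (@dop_1neq0 F).

Definition dop_scale (F : fieldType) (c : F) (P : diffop F) : diffop F :=
  DiffOp (c%:P%:F *: symb P).

Lemma dop_scaleA (F : fieldType) (a c : F) (P : diffop F) :
  dop_scale a (dop_scale c P) = dop_scale (a * c) P.
Proof. by apply: val_inj; rewrite /= scalerA polyCM tofracM. Qed.
Lemma dop_scale1 (F : fieldType) : left_id 1 (@dop_scale F).
Proof. by move=> P; apply: val_inj; rewrite /= polyC1 tofrac1 scale1r. Qed.
Lemma dop_scaleDr (F : fieldType) : right_distributive (@dop_scale F) +%R.
Proof. by move=> c P Q; apply: val_inj; rewrite /= scalerDr. Qed.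
Lemma dop_scaleDl (F : fieldType) (P : diffop F) :
  {morph (@dop_scale F)^~ P : a c / a + c}.
Proof. by move=> a c; apply: val_inj; rewrite /= polyCD tofracD scalerDl. Qed.

HB.instance Definition _ (F : fieldType) :=
  GRing.Zmodule_isLmodule.Build F (diffop F) (@dop_scaleA F) (@dop_scale1 F)
    (@dop_scaleDr F) (@dop_scaleDl F).

Lemma dop_scaleAl (F : fieldType) (c : F) (P Q : diffop F) :
  c *: (P * Q) = (c *: P) * Q.
Proof. by apply: val_inj; rewrite /= dcompZl. Qed.

HB.instance Definition _ (F : fieldType) :=
  GRing.Lmodule_isLalgebra.Build F (diffop F) (@dop_scaleAl F).

Lemma dop_scaleAr (F : fieldType) (c : F) (P Q : diffop F) :
  c *: (P * Q) = P * (c *: Q).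
Proof.
apply: val_inj; rewrite /= scaler_sumr; apply: eq_bigr => i _.
rewrite scalerA mulrC -scalerA; congr (_ *: _).
elim: (i : nat) => //= j <-.
by rewrite dcomp1Z rdiff_const scale0r add0r.
Qed.

HB.instance Definition _ (F : fieldType) :=
  GRing.Lalgebra_isAlgebra.Build F (diffop F) (@dop_scaleAr F).

Definition dapply (F : fieldType) (P : diffop F) (f : ratfun F) : ratfun F :=
  \sum_(i < size (symb P)) (symb P)`_i * iter i (@rdiff F) f.

Lemma dapply_widen (F : fieldType) n (P : diffop F) f : (size (symb P) <= n)%N ->
  dapply P f = \sum_(i < n) (symb P)`_i * iter i (@rdiff F) f.
Proof.
move=> le_pn; rewrite /dapply.
rewrite (big_ord_widen _ (fun i => (symb P)`_i * iter i _ f) le_pn).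
rewrite big_mkcond; apply: eq_bigr => i _; case: ltnP => // le_pi.
by rewrite nth_default // mul0r.
Qed.

Lemma dapplyD (F : fieldType) (P Q : diffop F) f :
  dapply (P + Q) f = dapply P f + dapply Q f.
Proof.
set n := maxn (size (symb P)) (size (symb Q)).
rewrite !(@dapply_widen _ n) ?leq_maxl ?leq_maxr ?size_polyD // -big_split /=.
by apply: eq_bigr => i _; rewrite coefD mulrDl.
Qed.

Lemma dapplyM (F : fieldType) (P Q : diffop F) f :
  dapply (P * Q) f = dapply P (dapply Q f).
Proof.
have dD p q : dapply (DiffOp (p + q)) f = dapply (DiffOp p) f + dapply (DiffOp q) f.
  exact: (@dapplyD F (DiffOp p) (DiffOp q)).
have d0 : dapply (DiffOp 0) f = 0 by rewrite /dapply size_poly0 big_ord0.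
have dZ (g : ratfun F) q : dapply (DiffOp (g *: q)) f = g * dapply (DiffOp q) f.
  rewrite (@dapply_widen _ (size q)) ?size_scale_leq // mulr_sumr.
  by apply: eq_bigr => i _; rewrite coefZ mulrA.
have d1 q : dapply (DiffOp (dcomp1 q)) f = rdiff (dapply (DiffOp q) f).
  have le : (size (q * 'X)%R <= (size q).+1)%N.
    by apply: leq_trans (size_polyMleq _ _) _; rewrite size_polyX addn2.
  rewrite dD (@dapply_widen _ (size q)) ?size_poly //.
  rewrite (@dapply_widen _ (size q).+1) // big_ord_recl /= coefMX mul0r add0r.
  rewrite raddf_sum -big_split /=; apply: eq_bigr => i _.
  by rewrite coefMX coef_map /= rdiffM.
rewrite [LHS](big_morph (fun p => dapply (DiffOp p) f) dD d0).
apply: eq_bigr => i _; rewrite dZ; congr (_ * _).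
by case: Q => q; elim: (i : nat) => //= j <-; rewrite d1.
Qed.

Definition ddx (F : fieldType) : diffop F := DiffOp 'X.

Definition mulop (F : fieldType) (f : ratfun F) : diffop F := DiffOp f%:P.

Lemma dapply_ddx (F : fieldType) (f : ratfun F) : dapply (ddx F) f = rdiff f.
Proof.
rewrite /dapply size_polyX !big_ord_recl big_ord0 !coefX /=.
by rewrite mul0r mul1r add0r addr0.
Qed.

Lemma dapply_mulop (F : fieldType) (f g : ratfun F) : dapply (mulop f) g = f * g.
Proof.
rewrite (@dapply_widen _ 1) ?size_polyC_leq1 // big_ord_recl big_ord0 addr0.
by rewrite coefC.
Qed.

Definition xvar (F : fieldType) : ratfun F := ('X : {poly F})%:F.

Definition rconst (F : fieldType) (c : F) : ratfun F := c%:P%:F.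

(* Scalars enter the algebra of operators as k%:A, i.e. k times the identity. *)
Definition T2 (F : fieldType) : diffop F :=
  ddx F ^+ 2 - mulop (2 * xvar F) * ddx F.

Definition Uop (F : fieldType) (b : F) : diffop F := ddx F + b%:A.

Definition Vop (F : fieldType) (b : F) : diffop F :=
  - ddx F + mulop (2 * xvar F) + b%:A.

Definition xb_inv (F : fieldType) (b : F) : diffop F :=
  mulop (xvar F + rconst b)^-1.

Definition Ahat (F : fieldType) (b : F) : diffop F :=
  T2 F + (b ^+ 2)%:A - xb_inv b * Uop b.

Definition Ahat_dag (F : fieldType) (b : F) : diffop F :=
  T2 F + (b ^+ 2)%:A - Vop b * xb_inv b.

Definition p2 (F : fieldType) (b : F) : {poly F} :=
  ('X + (b ^+ 2)%:P) * ('X + (b ^+ 2)%:P - 2%:P).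

(* Main.v *)
Require Import Defs.
From mathcomp Require Import all_boot all_order all_algebra.
From mathcomp Require Import reals complex.
From mathcomp Require Import fraction.

Local Open Scope ring_scope.
Import GRing.Theory.

(** Put [S = T_2 + b^2], [y = x + b] and [w = 1/y].  Then [U + V = 2 y] and
    [S = 2 b y - V U], so the cross terms of [(S - V w) (S - w U)] are
    [V w S + S w U - V w^2 U = 2 b (V + U) - V (w V + U w + w^2) U].
    Since [U w = w U - w^2], the bracket is [w (U + V) = 2], and the whole is
    [4 b y - 2 V U = 2 S]. *)

(** [mulop] embeds the commutative field of rational functions in the operators, so identities
    between multipliers can be checked in that field. *)
Lemma mulopM (F : fieldType) (f g : ratfun F) :
  mulop (f * g) = mulop f * mulop g.
Proof.
by apply: val_inj; rewrite /= dcompCl -mul_polyC polyCM.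
Qed.

Lemma mulopD (F : fieldType) (f g : ratfun F) :
  mulop (f + g) = mulop f + mulop g.
Proof. by apply: val_inj; rewrite /= polyCD. Qed.

Lemma mulopN (F : fieldType) (f : ratfun F) : mulop (- f) = - mulop f.
Proof. by apply: val_inj; rewrite /= polyCN. Qed.

Lemma mulop1 (F : fieldType) : mulop 1 = 1 :> diffop F.
Proof. by apply: val_inj; rewrite /= polyC1. Qed.

Lemma mulop_const (F : fieldType) (c : F) : mulop (rconst c) = c%:A.
Proof. by apply: val_inj; rewrite /= alg_polyC. Qed.

Lemma ddx_mulop (F : fieldType) (f : ratfun F) :
  ddx F * mulop f = mulop f * ddx F + mulop (rdiff f).
Proof.
apply: val_inj; rewrite /= dcompCl /dcomp size_polyX !big_ord_recl big_ord0 /=.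
by rewrite !coefX scale0r add0r scale1r addr0 /dcomp1 map_polyC mul_polyC addrC.
Qed.

(** Differentiate [f * f^-1 = 1]. *)
Lemma rdiffV (F : fieldType) (f : ratfun F) :
  f != 0 -> rdiff f^-1 = - (rdiff f * f^-1 ^+ 2).
Proof.
move=> nzf; apply: (mulfI nzf).
have /eqP : rdiff (f * f^-1) = 0.
  by rewrite divff // -tofrac1 -polyC1 rdiff_const.
rewrite rdiffM addrC addr_eq0 => /eqP ->.
by rewrite mulrN mulrCA [f^-1 ^+ 2]expr2 mulVKf.
Qed.

(** The noncommutative computation, reduced to the relations it uses. [U + V] stands for 2 y; each
    cross term cancels [w] against it on a different side. *)
Lemma factorization (K : fieldType) (A : algType K) (b : K) (U V S w : A) :
  w * (U + V) = 2 -> (U + V) * w = 2 -> S = b *: (U + V) - V * U ->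
  U * w = w * U - w ^+ 2 ->
  (S - V * w) * (S - w * U) = S * (S - 2).
Proof.
move=> wUV UVw SE Uw.
have bracket : w * V + U * w = 2 - w ^+ 2.
  by rewrite Uw addrA -mulrDr [V + U]addrC wUV.
have VwS : V * w * S = b *: (V * 2) - V * (w * V) * U.
  by rewrite SE mulrBr -scalerAr -[V * w * (U + V)]mulrA wUV !mulrA.
have SwU : S * (w * U) = b *: (2 * U) - V * (U * w) * U.
  by rewrite SE mulrBl -scalerAl [(U + V) * _]mulrA UVw !mulrA.
have cross : V * w * S + S * (w * U) = S * 2 + V * w * (w * U).
  (* The -w^2 in [bracket] yields the term V w^2 U; the rest is 2 b (U + V) - 2 V U = 2 S. *)
  rewrite VwS SwU addrACA -opprD -scalerDr -mulrDl -mulrDr bracket.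
  rewrite mulrBr mulrBl opprB SE mulrBl -scalerAl.
  rewrite !mulr_natr !mulr_natl -mulrnDl [V + U]addrC mulrnAl.
  by rewrite expr2 !mulrA addrCA addrC.
have -> : S * (S - 2) = S * S - (V * w * S + S * (w * U) - V * w * (w * U)).
  by rewrite mulrBr cross addrK.
rewrite mulrBl !mulrBr !opprB -addrA; congr (_ + _).
by rewrite addrCA -opprD [S * _ + _]addrC.
Qed.

Lemma ladder_factorization (K : fieldType) (A : algType K) (b : K) (D X w : A) :
  let S := D ^+ 2 - X * D + (b ^+ 2)%:A in
  w * (X + b%:A *+ 2) = 2 -> (X + b%:A *+ 2) * w = 2 ->
  D * w = w * D - w ^+ 2 ->
  (S - (- D + X + b%:A) * w) * (S - w * (D + b%:A)) = S * (S - 2).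
Proof.
move=> S wUV UVw Dw.
have UV : D + b%:A + (- D + X + b%:A) = X + b%:A *+ 2.
  by rewrite -[- D + X + _]addrA addrACA subrr add0r addrCA -mulr2n.
apply: (@factorization _ _ b); rewrite ?UV //; last first.
  (* [b%:A] is central, so [U] has the same commutator with [w] as [D]. *)
  by rewrite mulrDl mulrDr mulr_algl mulr_algr Dw addrAC.
rewrite -UV; set U := D + b%:A; set V := - D + X + b%:A.
(* Here V - b = -D + X and U - b = D. Expanding the product cancels b^2 and leaves b (U + V) - V
   U. *)
have -> : S = (b ^+ 2)%:A - (V - b%:A) * (U - b%:A).
  by rewrite /S /U /V !addrK mulrDl mulNr -expr2 opprD opprK addrC.
rewrite mulrBl !mulrBr !mulr_algl !mulr_algr scalerA -expr2.
by rewrite [b *: (U + V)]scalerDr !opprB addrA [_%:A + _]addrC subrK addrA.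
Qed.

Lemma Ahat_dag_mul_Ahat (F : fieldType) (b : F) :
  Ahat_dag b * Ahat b = horner_alg (T2 F) (p2 b).
Proof.
have nzy : xvar F + rconst b != 0.
  by rewrite /xvar /rconst -tofracD tofrac_eq0 -size_poly_eq0 size_XaddC.
have dy : rdiff (xvar F + rconst b) = 1.
  by rewrite rdiffD rdiff_const addr0 rdiff_poly derivX tofrac1.
have m2 : mulop 2 = 2 :> diffop F by rewrite mulopD mulop1.
have X2b : mulop (2 * xvar F) + b%:A *+ 2 = mulop (2 * (xvar F + rconst b)).
  rewrite mulrDr mulopD [mulop (2 * rconst b)]mulopM mulop_const m2.
  by congr (_ + _); rewrite mulr_natl.
(* Evaluating [p2 b] at T_2 gives S (S - 2) with S = T_2 + b^2. *)
rewrite /p2 rmorphM rmorphB !rmorphD /= !horner_algX !horner_algC !scale1r.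
apply: ladder_factorization.
- by rewrite X2b /xb_inv -[LHS]mulopM mulrCA (mulVf nzy) mulr1.
- by rewrite X2b /xb_inv -[LHS]mulopM -mulrA (divff nzy) mulr1.
(* By the Leibniz rule the correction term is the derivative of 1/y, which is -1/y^2 as y' = 1. *)
- rewrite /xb_inv ddx_mulop (rdiffV _ _ nzy) dy mul1r; congr (_ + _).
  by rewrite mulopN [in RHS]expr2 -mulopM.
Qed.

Theorem lemma3p2 (R : realType) (b : R[i]) :
  Ahat_dag b * Ahat b = horner_alg (T2 R[i]) (p2 b).
Proof. exact: Ahat_dag_mul_Ahat. Qed.
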